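(* Let $\Lambda\subset\mathbb{R}^2$ be open, $x=(x^1,x^2)$, and let $$\mathcal{P}(2)=g_{0,1}\mathrm{D}_{0,1}+g_{1,1}\mathrm{D}_{1,1}+g_{1,2}\mathrm{D}_{1,2}+g_{2,1}\mathrm{D}_{2,1}+g_{2,2}\mathrm{D}_{2,2}+g_{2,3}\mathrm{D}_{2,3}+g_{2,4}\mathrm{D}_{2,4},\qquad g_{k,h}\in\mathcal{C}(\Lambda,\mathbb{R}).$$ A necessary and sufficient condition for $\mathcal{P}(2)$ to be decomposed into the form $$\mathcal{P}(2)=\big[b_{1,0,1}\mathrm{D}_{0,1}+b_{1,1,1}\mathrm{D}_{1,1}+b_{1,1,2}\mathrm{D}_{1,2}\big]\big[b_{2,0,1}\mathrm{D}_{0,1}+b_{2,1,1}\mathrm{D}_{1,1}+b_{2,1,2}\mathrm{D}_{1,2}\big],$$ with $b_{1,k,h}\in\mathcal{C}(\Lambda,\mathbb{R})$ and $b_{2,k,h}\in\mathcal{C}^1(\Lambda,\mathbb{R})$, is that these functions satisfy on $\Lambda$ \begin{align*} g_{2,1}&=b_{1,1,1}b_{2,1,1},\\ g_{2,2}+g_{2,3}&=b_{1,1,2}b_{2,1,1}+b_{1,1,1}b_{2,1,2},\\ g_{2,4}&=b_{1,1,2}b_{2,1,2},\\ g_{1,1}&=b_{1,0,1}b_{2,1,1}+b_{1,1,1}b_{2,0,1}+\mathcal{L}(b_{2,1,1}),\\ g_{1,2}&=b_{1,0,1}b_{2,1,2}+b_{1,1,2}b_{2,0,1}+\mathcal{L}(b_{2,1,2}),\\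 g_{0,1}&=b_{1,0,1}b_{2,0,1}+\mathcal{L}(b_{2,0,1}), \end{align*} where $\mathcal{L}=b_{1,1,1}\mathrm{D}_{1,1}+b_{1,1,2}\mathrm{D}_{1,2}$.
   Context: Here $\mathrm{D}_{0,1}u=u$, $\mathrm{D}_{1,1}u=u_{x^1}$, $\mathrm{D}_{1,2}u=u_{x^2}$, $\mathrm{D}_{2,1}u=u_{2x^1}=\frac{\partial^2u}{(\partial x^1)^2}$, $\mathrm{D}_{2,2}u=\frac{\partial}{\partial x^2}\frac{\partial u}{\partial x^1}$, $\mathrm{D}_{2,3}u=\frac{\partial}{\partial x^1}\frac{\partial u}{\partial x^2}$, $\mathrm{D}_{2,4}u=u_{2x^2}=\frac{\partial^2u}{(\partial x^2)^2}$. The product of two bracketed operators is their composition (the right factor acts first). Equality of operators means that both sides give the same result on every $u\in\mathcal{C}^2(\Lambda_0,\mathbb{R})$, for open $\Lambda_0\subset\Lambda$. *)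

(* Defs.v *)
(* Stdlib reals with Coquelicot. *)
From Stdlib Require Import Reals.
From Coquelicot Require Import Coquelicot.
Open Scope R_scope.

(* A function of x = (x1, x2) on an open set is represented by a total function
   R -> R -> R of which only the values on that set matter: at a point of an
   open set, continuity and the partial derivatives are local notions. *)

(* [ex_diff_n f k x1 x2] asserts that the partial derivatives of f of order
   <= k, in every order of differentiation, exist at (x1, x2) and are
   continuous there. *)
Definition is_Cn (k : nat) (A : R * R -> Prop) (f : R -> R -> R) : Prop :=
  forall x1 x2 : R, A (x1, x2) -> ex_diff_n f k x1 x2.

Definition operator : Type := (R -> R -> R) -> R -> R -> R.

Definition D01 : operator := fun u => u.
Definition D11 : operator := fun u x1 x2 => Derive (fun t => u t x2) x1.
Definition D12 : operator := fun u x1 x2 => Derive (fun t => u x1 t) x2.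
Definition D21 : operator := fun u => D11 (D11 u).
Definition D22 : operator := fun u => D12 (D11 u).
Definition D23 : operator := fun u => D11 (D12 u).
Definition D24 : operator := fun u => D12 (D12 u).

Definition op_comp (P Q : operator) : operator := fun u => P (Q u).

Definition first_order_op (b01 b11 b12 : R -> R -> R) : operator :=
  fun u x1 x2 =>
    b01 x1 x2 * D01 u x1 x2 + b11 x1 x2 * D11 u x1 x2
    + b12 x1 x2 * D12 u x1 x2.

Definition second_order_op (g01 g11 g12 g21 g22 g23 g24 : R -> R -> R) :
    operator :=
  fun u x1 x2 =>
    g01 x1 x2 * D01 u x1 x2
    + g11 x1 x2 * D11 u x1 x2 + g12 x1 x2 * D12 u x1 x2
    + g21 x1 x2 * D21 u x1 x2 + g22 x1 x2 * D22 u x1 x2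
    + g23 x1 x2 * D23 u x1 x2 + g24 x1 x2 * D24 u x1 x2.

Definition transport_op (b11 b12 : R -> R -> R) : operator :=
  fun u x1 x2 => b11 x1 x2 * D11 u x1 x2 + b12 x1 x2 * D12 u x1 x2.

Definition op_eq_on (Lam : R * R -> Prop) (P Q : operator) : Prop :=
  forall Lam0 : R * R -> Prop,
    open Lam0 -> (forall p, Lam0 p -> Lam p) ->
    forall u : R -> R -> R, is_Cn 2 Lam0 u ->
    forall x1 x2 : R, Lam0 (x1, x2) -> P u x1 x2 = Q u x1 x2.

(* Main.v *)
Require Import Defs.
From Stdlib Require Import Reals Lra.
From Coquelicot Require Import Coquelicot.
Open Scope R_scope.

(** Expanding the product of the two first-order factors by the Leibniz rule
    gives a second-order operator whose coefficients are read off at once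
    ([first_order_op_comp]): those of D21, D24, D11, D12, D01 are the right-hand
    sides of the corresponding conditions, while D22 and D23 receive
    [b112 * b211] and [b111 * b212].  The proposition therefore says when two
    second-order operators coincide ([second_order_op_eq_iff]).

    On functions of class C^2 the mixed derivatives D22 u and D23 u are equal
    (Schwarz), so an operator only sees the sum of their two coefficients; this
    is why one condition involves [g22 + g23] and why the conditions are
    sufficient.  They are necessary because nothing else is lost: at any point
    there is a polynomial of degree at most two with a prescribed 2-jet, and
    letting the jet run through the six basis vectors isolates the six
    coefficients. *)

(** The quadratic polynomial whose 2-jet at [(p1, p2)] is
    [(j0, j1, j2, j11, j12, j22)].  With this normalisation of the coefficients
    a partial derivative acts on the jet as a mere shift. *)
Definition jet_poly (p1 p2 j0 j1 j2 j11 j12 j22 : R) (s t : R) : R :=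
  j0 + j1 * (s - p1) + j2 * (t - p2)
  + j11 * ((s - p1) * (s - p1) / 2) + j12 * ((s - p1) * (t - p2))
  + j22 * ((t - p2) * (t - p2) / 2).

Lemma jet_poly_center (p1 p2 j0 j1 j2 j11 j12 j22 : R) :
  jet_poly p1 p2 j0 j1 j2 j11 j12 j22 p1 p2 = j0.
Proof. unfold jet_poly; field. Qed.

Lemma is_derive_jet_poly_1 (p1 p2 j0 j1 j2 j11 j12 j22 s t : R) :
  is_derive (fun z => jet_poly p1 p2 j0 j1 j2 j11 j12 j22 z t) s
    (jet_poly p1 p2 j1 j11 j12 0 0 0 s t).
Proof. unfold jet_poly; auto_derive; [exact I | field]. Qed.

Lemma is_derive_jet_poly_2 (p1 p2 j0 j1 j2 j11 j12 j22 s t : R) :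
  is_derive (fun z => jet_poly p1 p2 j0 j1 j2 j11 j12 j22 s z) t
    (jet_poly p1 p2 j2 j12 j22 0 0 0 s t).
Proof. unfold jet_poly; auto_derive; [exact I | field]. Qed.

Lemma D11_jet_poly (p1 p2 j0 j1 j2 j11 j12 j22 s t : R) :
  D11 (jet_poly p1 p2 j0 j1 j2 j11 j12 j22) s t
  = jet_poly p1 p2 j1 j11 j12 0 0 0 s t.
Proof. apply is_derive_unique, is_derive_jet_poly_1. Qed.

Lemma D12_jet_poly (p1 p2 j0 j1 j2 j11 j12 j22 s t : R) :
  D12 (jet_poly p1 p2 j0 j1 j2 j11 j12 j22) s t
  = jet_poly p1 p2 j2 j12 j22 0 0 0 s t.
Proof. apply is_derive_unique, is_derive_jet_poly_2. Qed.

Lemma continuity_2d_pt_jet_poly (p1 p2 j0 j1 j2 j11 j12 j22 s t : R) :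
  continuity_2d_pt (jet_poly p1 p2 j0 j1 j2 j11 j12 j22) s t.
Proof.
  unfold jet_poly, Rdiv.
  repeat (apply continuity_2d_pt_plus || apply continuity_2d_pt_mult
          || apply continuity_2d_pt_minus || apply continuity_2d_pt_const
          || apply continuity_2d_pt_id1 || apply continuity_2d_pt_id2).
Qed.

(** The family [jet_poly p1 p2] is stable under both partial derivatives, so
    its continuity propagates to all orders. *)
Lemma ex_diff_n_jet_poly (n : nat) (p1 p2 j0 j1 j2 j11 j12 j22 s t : R) :
  ex_diff_n (jet_poly p1 p2 j0 j1 j2 j11 j12 j22) n s t.
Proof.
  revert j0 j1 j2 j11 j12 j22.
  induction n as [|n IH]; intros j0 j1 j2 j11 j12 j22; simpl;
    (split; [apply continuity_2d_pt_jet_poly|]); [exact I|].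
  repeat split.
  - eexists; apply is_derive_jet_poly_1.
  - eexists; apply is_derive_jet_poly_2.
  - apply (ex_diff_n_ext_loc (jet_poly p1 p2 j1 j11 j12 0 0 0)); [|apply IH].
    apply locally_2d_forall; intros u v; symmetry; apply D11_jet_poly.
  - apply (ex_diff_n_ext_loc (jet_poly p1 p2 j2 j12 j22 0 0 0)); [|apply IH].
    apply locally_2d_forall; intros u v; symmetry; apply D12_jet_poly.
Qed.

Lemma second_order_op_jet_poly (g01 g11 g12 g21 g22 g23 g24 : R -> R -> R)
    (p1 p2 j0 j1 j2 j11 j12 j22 : R) :
  second_order_op g01 g11 g12 g21 g22 g23 g24
    (jet_poly p1 p2 j0 j1 j2 j11 j12 j22) p1 p2
  = g01 p1 p2 * j0 + g11 p1 p2 * j1 + g12 p1 p2 * j2 + g21 p1 p2 * j11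
    + (g22 p1 p2 + g23 p1 p2) * j12 + g24 p1 p2 * j22.
Proof.
  set (q := jet_poly p1 p2 j0 j1 j2 j11 j12 j22).
  assert (E11 : D21 q p1 p2 = j11).
  { transitivity (D11 (jet_poly p1 p2 j1 j11 j12 0 0 0) p1 p2).
    - apply Derive_ext; intro; apply D11_jet_poly.
    - now rewrite D11_jet_poly, jet_poly_center. }
  assert (E22 : D22 q p1 p2 = j12).
  { transitivity (D12 (jet_poly p1 p2 j1 j11 j12 0 0 0) p1 p2).
    - apply Derive_ext; intro; apply D11_jet_poly.
    - now rewrite D12_jet_poly, jet_poly_center. }
  assert (E23 : D23 q p1 p2 = j12).
  { transitivity (D11 (jet_poly p1 p2 j2 j12 j22 0 0 0) p1 p2).
    - apply Derive_ext; intro; apply D12_jet_poly.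
    - now rewrite D11_jet_poly, jet_poly_center. }
  assert (E24 : D24 q p1 p2 = j22).
  { transitivity (D12 (jet_poly p1 p2 j2 j12 j22 0 0 0) p1 p2).
    - apply Derive_ext; intro; apply D12_jet_poly.
    - now rewrite D12_jet_poly, jet_poly_center. }
  unfold second_order_op, D01; rewrite E11, E22, E23, E24; unfold q.
  rewrite D11_jet_poly, D12_jet_poly, !jet_poly_center; ring.
Qed.

Lemma is_Cn_locally_2d (n : nat) (A : R * R -> Prop) (f : R -> R -> R)
    (x1 x2 : R) :
  open A -> is_Cn n A f -> A (x1, x2) ->
  locally_2d (fun u v => ex_diff_n f n u v) x1 x2.
Proof.
  intros HA Hf Hx; apply locally_2d_locally.
  apply (filter_imp A); [|exact (HA _ Hx)].
  intros [u v]; apply Hf.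
Qed.

(** Schwarz's theorem asks for differentiability in a neighbourhood of the
    point, which is where the openness of [A] enters. *)
Lemma D22_D23 (A : R * R -> Prop) (u : R -> R -> R) (x1 x2 : R) :
  open A -> is_Cn 2 A u -> A (x1, x2) -> D22 u x1 x2 = D23 u x1 x2.
Proof.
  intros HA Hu Hx; symmetry; apply Schwarz.
  - apply (locally_2d_impl (fun v w => ex_diff_n u 2 v w));
      [|exact (is_Cn_locally_2d 2 A u x1 x2 HA Hu Hx)].
    apply locally_2d_forall; intros v w Hvw; simpl in Hvw; tauto.
  - pose proof (Hu _ _ Hx) as H; simpl in H; tauto.
  - pose proof (Hu _ _ Hx) as H; simpl in H; tauto.
Qed.

(** Necessity tests both operators on the quadratic polynomial with each basis
    2-jet at the given point; sufficiency merges the mixed derivatives by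
    Schwarz, after which only the sum of their coefficients matters. *)
Lemma second_order_op_eq_iff (A : R * R -> Prop)
    (g01 g11 g12 g21 g22 g23 g24 c01 c11 c12 c21 c22 c23 c24 : R -> R -> R) :
  open A ->
  op_eq_on A (second_order_op g01 g11 g12 g21 g22 g23 g24)
    (second_order_op c01 c11 c12 c21 c22 c23 c24)
  <->
  (forall x1 x2 : R, A (x1, x2) ->
    g21 x1 x2 = c21 x1 x2 /\
    g22 x1 x2 + g23 x1 x2 = c22 x1 x2 + c23 x1 x2 /\
    g24 x1 x2 = c24 x1 x2 /\
    g11 x1 x2 = c11 x1 x2 /\
    g12 x1 x2 = c12 x1 x2 /\
    g01 x1 x2 = c01 x1 x2).
Proof.
  intros HA; split.
  - intros Heq x1 x2 Hx.
    assert (T : forall j0 j1 j2 j11 j12 j22 : R,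
      second_order_op g01 g11 g12 g21 g22 g23 g24
        (jet_poly x1 x2 j0 j1 j2 j11 j12 j22) x1 x2
      = second_order_op c01 c11 c12 c21 c22 c23 c24
        (jet_poly x1 x2 j0 j1 j2 j11 j12 j22) x1 x2).
    { intros; apply (Heq A HA (fun _ H => H)); [|exact Hx].
      intros s t _; apply ex_diff_n_jet_poly. }
    pose proof (T 1 0 0 0 0 0) as T0; pose proof (T 0 1 0 0 0 0) as T1;
    pose proof (T 0 0 1 0 0 0) as T2; pose proof (T 0 0 0 1 0 0) as T11;
    pose proof (T 0 0 0 0 1 0) as T12; pose proof (T 0 0 0 0 0 1) as T22.
    rewrite !second_order_op_jet_poly in T0, T1, T2, T11, T12, T22.
    repeat split; lra.
  - intros H B HB HBA u Hu x1 x2 Hx.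
    destruct (H x1 x2 (HBA _ Hx)) as (E21 & E2m & E24 & E11 & E12 & E01).
    unfold second_order_op.
    rewrite (D22_D23 B u x1 x2 HB Hu Hx), E21, E24, E11, E12, E01.
    (* [g22] and [g23] are known only through their sum, so eliminate one of
       them: the other then cancels, both multiplying D23 u. *)
    replace (g23 x1 x2) with (c22 x1 x2 + c23 x1 x2 - g22 x1 x2) by lra.
    ring.
Qed.

Lemma Derive_sum3_mult (a0 a1 a2 v0 v1 v2 : R -> R) (x : R) :
  ex_derive a0 x -> ex_derive a1 x -> ex_derive a2 x ->
  ex_derive v0 x -> ex_derive v1 x -> ex_derive v2 x ->
  Derive (fun z => a0 z * v0 z + a1 z * v1 z + a2 z * v2 z) x
  = (Derive a0 x * v0 x + a0 x * Derive v0 x)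
    + (Derive a1 x * v1 x + a1 x * Derive v1 x)
    + (Derive a2 x * v2 x + a2 x * Derive v2 x).
Proof.
  intros Ha0 Ha1 Ha2 Hv0 Hv1 Hv2.
  rewrite (Derive_plus (fun z => a0 z * v0 z + a1 z * v1 z)).
  - rewrite (Derive_plus (fun z => a0 z * v0 z)) by (now apply ex_derive_mult).
    now rewrite !Derive_mult.
  - apply (ex_derive_plus (fun z => a0 z * v0 z)); now apply ex_derive_mult.
  - now apply ex_derive_mult.
Qed.

(** The Leibniz rule.  It is a pointwise identity, and the mixed derivatives
    are kept apart: D11 of the inner factor produces D23 from its D12 term, and
    D12 produces D22 from its D11 term. *)
Lemma first_order_op_comp (a0 a1 a2 b0 b1 b2 u : R -> R -> R) (x1 x2 : R) :
  ex_diff_n b0 1 x1 x2 -> ex_diff_n b1 1 x1 x2 -> ex_diff_n b2 1 x1 x2 ->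
  ex_diff_n u 2 x1 x2 ->
  op_comp (first_order_op a0 a1 a2) (first_order_op b0 b1 b2) u x1 x2
  = second_order_op
      (fun s t => a0 s t * b0 s t + transport_op a1 a2 b0 s t)
      (fun s t => a0 s t * b1 s t + a1 s t * b0 s t + transport_op a1 a2 b1 s t)
      (fun s t => a0 s t * b2 s t + a2 s t * b0 s t + transport_op a1 a2 b2 s t)
      (fun s t => a1 s t * b1 s t)
      (fun s t => a2 s t * b1 s t)
      (fun s t => a1 s t * b2 s t)
      (fun s t => a2 s t * b2 s t) u x1 x2.
Proof.
  intros (_ & Hb01 & Hb02 & _) (_ & Hb11 & Hb12 & _) (_ & Hb21 & Hb22 & _)
    (_ & Hu1 & Hu2 & (_ & Hu11 & Hu12 & _) & (_ & Hu21 & Hu22 & _)).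
  assert (E1 : D11 (first_order_op b0 b1 b2 u) x1 x2
    = (D11 b0 x1 x2 * u x1 x2 + b0 x1 x2 * D11 u x1 x2)
      + (D11 b1 x1 x2 * D11 u x1 x2 + b1 x1 x2 * D21 u x1 x2)
      + (D11 b2 x1 x2 * D12 u x1 x2 + b2 x1 x2 * D23 u x1 x2))
    by (apply (Derive_sum3_mult (fun z => b0 z x2) (fun z => b1 z x2)
                 (fun z => b2 z x2) (fun z => u z x2) (fun z => D11 u z x2)
                 (fun z => D12 u z x2)); assumption).
  assert (E2 : D12 (first_order_op b0 b1 b2 u) x1 x2
    = (D12 b0 x1 x2 * u x1 x2 + b0 x1 x2 * D12 u x1 x2)
      + (D12 b1 x1 x2 * D11 u x1 x2 + b1 x1 x2 * D22 u x1 x2)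
      + (D12 b2 x1 x2 * D12 u x1 x2 + b2 x1 x2 * D24 u x1 x2))
    by (apply (Derive_sum3_mult (fun z => b0 x1 z) (fun z => b1 x1 z)
                 (fun z => b2 x1 z) (fun z => u x1 z) (fun z => D11 u x1 z)
                 (fun z => D12 u x1 z)); assumption).
  unfold op_comp; unfold first_order_op at 1; rewrite E1, E2.
  unfold second_order_op, first_order_op, transport_op, D01; ring.
Qed.

Theorem proposition2p3
  (Lam : R * R -> Prop) (hLam : open Lam)
  (g01 g11 g12 g21 g22 g23 g24 : R -> R -> R)
  (hg01 : is_Cn 0 Lam g01)
  (hg11 : is_Cn 0 Lam g11) (hg12 : is_Cn 0 Lam g12)
  (hg21 : is_Cn 0 Lam g21) (hg22 : is_Cn 0 Lam g22)
  (hg23 : is_Cn 0 Lam g23) (hg24 : is_Cn 0 Lam g24)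
  (b101 b111 b112 b201 b211 b212 : R -> R -> R)
  (hb101 : is_Cn 0 Lam b101) (hb111 : is_Cn 0 Lam b111)
  (hb112 : is_Cn 0 Lam b112)
  (hb201 : is_Cn 1 Lam b201) (hb211 : is_Cn 1 Lam b211)
  (hb212 : is_Cn 1 Lam b212) :
  op_eq_on Lam
    (second_order_op g01 g11 g12 g21 g22 g23 g24)
    (op_comp (first_order_op b101 b111 b112) (first_order_op b201 b211 b212))
  <->
  (forall x1 x2 : R, Lam (x1, x2) ->
    g21 x1 x2 = b111 x1 x2 * b211 x1 x2 /\
    g22 x1 x2 + g23 x1 x2
      = b112 x1 x2 * b211 x1 x2 + b111 x1 x2 * b212 x1 x2 /\
    g24 x1 x2 = b112 x1 x2 * b212 x1 x2 /\
    g11 x1 x2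
      = b101 x1 x2 * b211 x1 x2 + b111 x1 x2 * b201 x1 x2
        + transport_op b111 b112 b211 x1 x2 /\
    g12 x1 x2
      = b101 x1 x2 * b212 x1 x2 + b112 x1 x2 * b201 x1 x2
        + transport_op b111 b112 b212 x1 x2 /\
    g01 x1 x2
      = b101 x1 x2 * b201 x1 x2 + transport_op b111 b112 b201 x1 x2).
Proof.
  rewrite <- (second_order_op_eq_iff Lam g01 g11 g12 g21 g22 g23 g24
    (fun s t => b101 s t * b201 s t + transport_op b111 b112 b201 s t)
    (fun s t => b101 s t * b211 s t + b111 s t * b201 s t
                + transport_op b111 b112 b211 s t)
    (fun s t => b101 s t * b212 s t + b112 s t * b201 s t
                + transport_op b111 b112 b212 s t)
    (fun s t => b111 s t * b211 s t) (fun s t => b112 s t * b211 s t)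
    (fun s t => b111 s t * b212 s t) (fun s t => b112 s t * b212 s t) hLam).
  split; intros H A HA HAL u Hu x1 x2 Hx; pose proof (HAL _ Hx) as HL;
    rewrite (H A HA HAL u Hu x1 x2 Hx); [|symmetry];
    (apply first_order_op_comp; [apply hb201 | apply hb211 | apply hb212 | apply Hu];
     assumption).
Qed.
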